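(* Let $G$ be a connected graph of order $n\geq 4$ and size $m$. Then \[ \chi_d^t(\overline{C(G)})=\begin{cases} n & \text{if } G \text{ is a tree},\\ m & \text{otherwise},\end{cases} \] where $\overline{C(G)}$ denotes the complement of $C(G)$.
   Context: All graphs are finite, simple and undirected; the size of a graph is its number of edges. For a graph $G=(V,E)$ with $V=\{v_1,\dots,v_n\}$, the central graph $C(G)$ is the graph with vertex set $V\cup\{c_{ij} : v_iv_j\in E\}$ obtained by subdividing each edge $v_iv_j$ of $G$ exactly once by a new vertex $c_{ij}$ (adjacent to exactly $v_i$ and $v_j$) and joining every pair of distinct vertices non-adjacent in $G$. A total dominator coloring (TDC) of a graph $H$ with no isolated vertices is a proper vertex coloring of $H$ in which every vertex is adjacent to all vertices of some color class. $\chi_d^t(H)$ is the minimum number of color classes in a TDC of $H$. *)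

(* Defs.v *)
From mathcomp Require Import all_boot.

Set Implicit Arguments.
Unset Strict Implicit.
Unset Printing Implicit Defensive.

Record sgraph := SGraph {
  vertex :> finType;
  adj : rel vertex;
  adj_sym : symmetric adj;
  adj_irr : irreflexive adj
}.

Section Basics.
Variable G : sgraph.

Definition edges : {set {set G}} :=
  [set [set p.1; p.2] | p : G * G & adj p.1 p.2].

Definition graph_order : nat := #|G|.
Definition graph_size : nat := #|edges|.

(* Nonemptiness is included, as is usual for connected graphs. *)
Definition connected_graph : Prop :=
  0 < graph_order /\ forall x y : G, connect (@adj G) x y.

(* A [ucycle] may have fewer than three vertices (an edge run back and forth is
   a [ucycle] of size 2), so the length condition is explicit. *)
Definition acyclic_graph : Prop :=
  forall s : seq G, 3 <= size s -> ~ ucycle (@adj G) s.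

Definition is_tree : Prop := connected_graph /\ acyclic_graph.

Definition no_isolated : Prop := forall x : G, exists y : G, adj x y.

End Basics.

Section Complement.
Variable G : sgraph.

Definition compl_adj (x y : G) : bool := (x != y) && ~~ adj x y.

Lemma compl_adj_sym : symmetric compl_adj.
Proof. by move=> x y; rewrite /compl_adj eq_sym adj_sym. Qed.

Lemma compl_adj_irr : irreflexive compl_adj.
Proof. by move=> x; rewrite /compl_adj eqxx. Qed.

Definition compl_graph : sgraph := SGraph compl_adj_sym compl_adj_irr.

End Complement.

Section Central.
Variable G : sgraph.

(* [inr a], for an edge [a = {v_i, v_j}], is the subdivision vertex c_ij. *)
Definition central_vertex : finType := (G + {a : {set G} | a \in edges G})%type.

Definition central_adj (u v : central_vertex) : bool :=
  match u, v with
  | inl x, inl y => (x != y) && ~~ adj x y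
  | inl x, inr a => x \in val a
  | inr a, inl x => x \in val a
  | inr _, inr _ => false
  end.

Lemma central_adj_sym : symmetric central_adj.
Proof. by move=> [x|a] [y|b] //=; rewrite eq_sym adj_sym. Qed.

Lemma central_adj_irr : irreflexive central_adj.
Proof. by move=> [x|a] //=; rewrite eqxx. Qed.

Definition central_graph : sgraph := SGraph central_adj_sym central_adj_irr.

End Central.

Section TotalDominatorColoring.
Variable H : sgraph.

(* Colorings are given by their color classes, i.e. as partitions of the vertex
   set; in particular every color class is nonempty. *)
Definition proper_coloring (P : {set {set H}}) : bool :=
  partition P [set: H] &&
  [forall A in P, forall x in A, forall y in A, ~~ adj x y].

Definition tdc (P : {set {set H}}) : bool :=
  proper_coloring P && [forall x, exists A in P, forall y in A, adj x y].

Definition discrete_coloring : {set {set H}} := [set [set x] | x : H].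

(* The minimum number of classes of a TDC; meaningful when [H] has no isolated
   vertices, in which case [discrete_coloring] is a TDC (see [tdc_numberP]). *)
Definition tdc_number : nat :=
  #|[arg min_(P < discrete_coloring | tdc P) #|P| ]|.

Lemma discrete_coloring_tdc : no_isolated H -> tdc discrete_coloring.
Proof.
move=> noiso; apply/andP; split; last first.
  apply/forallP=> x; have [y xy] := noiso x.
  apply/existsP; exists [set y]; rewrite imset_f //=.
  by apply/forall_inP=> z /set1P ->.
apply/andP; split; last first.
  apply/forall_inP=> _ /imsetP[x _ ->].
  by apply/forall_inP=> _ /set1P->; apply/forall_inP=> _ /set1P->; rewrite adj_irr.
apply/and3P; split.
- apply/eqP/setP=> x; rewrite inE; apply/bigcupP.
  by exists [set x]; rewrite ?imset_f ?set11.
- apply/trivIsetP=> _ _ /imsetP[x _ ->] /imsetP[y _ ->] xy.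
  by rewrite disjoints1 inE; apply: contraNneq xy => ->.
- by apply/imsetP=> -[x _ /setP/(_ x)]; rewrite !inE eqxx.
Qed.

Lemma tdc_numberP : no_isolated H ->
  (exists2 P, tdc P & #|P| = tdc_number) /\
  (forall P, tdc P -> tdc_number <= #|P|).
Proof.
move=> /discrete_coloring_tdc tdc0; rewrite /tdc_number.
by case: arg_minnP => // P tP minP; split=> //; exists P.
Qed.

End TotalDominatorColoring.

(* So [tdc_number] is the genuine minimum for complements of central graphs. *)
Lemma compl_central_no_isolated (G : sgraph) :
  connected_graph G -> 2 < graph_order G ->
  no_isolated (compl_graph (central_graph G)).
Proof.
move=> [_ conn] n3 [x|[a ea]].
  have [y xy]: exists y, y != x.
    have: 0 < #|[set~ x]| by rewrite cardsC1 -subn1 subn_gt0; apply: ltnW.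
    by case/card_gt0P=> y; rewrite !inE; exists y.
  have /connectP[[|z p] /=] := conn x y; first by move=> _ /eqP; rewrite (negPf xy).
  case/andP=> xz _ _; exists (inl z).
  rewrite /= /compl_adj /= xz andbF andbT.
  by apply: contraTneq xz => -[->]; rewrite adj_irr.
have a2: #|a| <= 2.
  by case/imsetP: (ea) => p _ ->; rewrite cards2; case: (_ != _).
have: 0 < #|~: a| by rewrite cardsCs setCK subn_gt0; apply: leq_ltn_trans a2 n3.
by case/card_gt0P=> y; rewrite inE => ya; exists (inl y); rewrite /= /compl_adj /= ya.
Qed.

(* Main.v *)
Require Import Defs.
From mathcomp Require Import all_boot.

(** In the complement [H] of [C(G)] the subdivision vertices form a clique, a
    vertex [x] of [G] is adjacent to the edge-vertex [a] iff [x] is not an end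
    of [a], and [H] induces [G] on the vertices of [G].  A color class thus
    contains at most one edge-vertex, and together with it at most one vertex
    of [G], which is one of its ends.  So at least [m] colors are needed, and
    exactly [m] colors force an injection of the vertices into the edges, hence
    [n <= m].

    If [G] has a cycle, send each vertex of the cycle to its successor and every
    other vertex to a neighbor closer to the cycle.  This map [g] satisfies
    [g (g v) != v], so [v |-> {v, g v}] is injective, and coloring [v] like the
    edge [{v, g v}] gives a TDC: [x] is dominated by the class of [g x].

    If [G] is a tree, take a path [r - c - b], root [G] at [r], color [v] like
    the edge to its parent, except that [r] and [b] form a class of their own.
    Then the edge [{b, c}] is alone in its class and dominates nearly
    everything. *)

Set Implicit Arguments.
Unset Strict Implicit.
Unset Printing Implicit Defensive.

(** * Pairs, distances and cycles *)

Lemma set2_eq (T : finType) (x y u v : T) :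
  [set x; y] = [set u; v] -> (x = u /\ y = v) \/ (x = v /\ y = u).
Proof.
move=> /setP E; have := (E x, E y, E u, E v); rewrite !inE !eqxx !orbT /=.
case=> [[[/esym/orP[]/eqP-> /esym/orP[]/eqP->] h3] h4];
  move: h3 h4; rewrite ?eqxx ?orbT ?orbb; try by [left | right].
  by move=> _ /eqP->; left.
by move=> /eqP-> _; left.
Qed.

Section Descent.
Variables (T : finType) (e : rel T) (S : {set T}).

(** Walks of exactly [n] steps from [v] into [S]; the least such [n] is the distance to [S]. *)
Fixpoint reach n v :=
  if n is k.+1 then [exists w, e v w && reach k w] else v \in S.

Lemma connect_reach v s : connect e v s -> s \in S -> exists n, reach n v.
Proof.
case/connectP=> p; elim: p v => [|w p IH] v /=; first by move=> _ -> ?; exists 0.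
case/andP=> evw pth ls sS; have [n rn] := IH w pth ls sS.
by exists n.+1; apply/existsP; exists w; rewrite evw.
Qed.

(** With [d] the distance to [S], the first step of a shortest walk lowers [d]. *)
Lemma connect_descent :
  (forall v, exists2 s, s \in S & connect e v s) ->
  exists (p : T -> T) (d : T -> nat),
    forall v, v \notin S -> e v (p v) /\ d (p v) < d v.
Proof.
move=> conn.
have ex v : exists n, reach n v.
  by have [s sS cs] := conn v; apply: connect_reach cs sS.
pose d v := ex_minn (ex v).
exists (fun v => odflt v [pick w | e v w && (d w < d v)]), d => v vS.
case: pickP => [w /andP[] //|none]; exfalso.
move: (erefl (d v)); rewrite {1}/d; case: ex_minnP => -[|n] /=.
  by rewrite (negPf vS).
case/existsP=> w /andP[evw rw] _ dv; move: (none w); rewrite evw -dv ltnS /d.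
by case: ex_minnP => k _ ->.
Qed.

End Descent.

(** Once [s] is rotated to start at [v], the second successor is its third entry. *)
Lemma next_next_neq (T : eqType) (s : seq T) v :
  uniq s -> 2 < size s -> v \in s -> next s (next s v) != v.
Proof.
move=> us s3 /rot_to[i t et]; rewrite -!(next_rot i us) et.
have : uniq (v :: t) by rewrite -et rot_uniq.
have : 2 < size (v :: t) by rewrite -et size_rot.
case: t {et} => [|x [|y t]] //= _; rewrite !inE !negb_or => /and3P[/and3P[vx vy _] _ _].
by rewrite eqxx [x == v]eq_sym (negPf vx) eqxx eq_sym.
Qed.

(** * Adjacency in [H] and the lower bounds *)

Section Graph.
Variable G : sgraph.
Implicit Types (x y v w : G).

Notation E := {a : {set G} | a \in edges G}.
Notation H := (compl_graph (central_graph G)).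

Lemma edgesP (a : {set G}) :
  reflect (exists x y, adj x y /\ a = [set x; y]) (a \in edges G).
Proof.
apply: (iffP imsetP) => [[[x y] /= xy ->]|[x [y [xy ->]]]]; last first.
  by exists (x, y); rewrite ?inE.
by rewrite inE in xy; exists x, y.
Qed.

Lemma edge_of x y : adj x y -> [set x; y] \in edges G.
Proof. by move=> xy; apply/edgesP; exists x, y. Qed.

Lemma card_edge_type : #|{: E}| = graph_size G.
Proof. by rewrite card_sig. Qed.

Lemma card_edge (a : E) : #|val a| <= 2.
Proof. by have /edgesP[x [y [_ ->]]] := valP a; rewrite cards2; case: (_ != _). Qed.

Lemma adj_neq x y : adj x y -> x != y.
Proof. by apply: contraTneq => ->; rewrite adj_irr. Qed.

Lemma compl_central_ll x y : adj (inl x : H) (inl y : H) = adj x y.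
Proof.
rewrite /= /compl_adj /= negb_and !negbK.
have -> : (inl x != inl y :> G + E) = (x != y) by [].
by case: eqVneq => [->|_] //=; rewrite adj_irr.
Qed.

Lemma compl_central_lr x (a : E) : adj (inl x : H) (inr a : H) = (x \notin val a).
Proof. by []. Qed.

Lemma compl_central_rl x (a : E) : adj (inr a : H) (inl x : H) = (x \notin val a).
Proof. by []. Qed.

Lemma compl_central_rr (a b : E) : adj (inr a : H) (inr b : H) = (a != b).
Proof. by rewrite /= /compl_adj andbT. Qed.

Definition compl_centralE :=
  (compl_central_ll, compl_central_lr, compl_central_rl, compl_central_rr).

Lemma proper_coloring_lower (P : {set {set H}}) : proper_coloring P ->
  graph_size G <= #|P| /\ (graph_size G < #|P| \/ graph_order G <= #|P|).
Proof.
case/andP=> /and3P[/eqP cP tI _] /forall_inP prop.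
have inP (u : H) : pblock P u \in P by rewrite pblock_mem // cP inE.
have inB (u : H) : u \in pblock P u by rewrite mem_pblock cP inE.
have indep (u v w : H) : u \in pblock P w -> v \in pblock P w -> ~~ adj u v.
  by move=> hu hv; move: (forall_inP (prop _ (inP w)) u hu) => /forall_inP; apply.
pose f (a : E) : {set H} := pblock P (inr a).
have finj : injective f.
  move=> a b fab; apply/eqP; rewrite -[_ == _]negbK -compl_central_rr.
  by apply: (@indep _ _ (inr a)); rewrite ?inB //= -/(f a) fab inB.
have fP : f @: [set: E] \subset P by apply/subsetP=> _ /imsetP[a _ ->]; apply: inP.
have cf : #|f @: [set: E]| = graph_size G.
  by rewrite card_imset // cardsT card_edge_type.
have mP : graph_size G <= #|P| by rewrite -cf subset_leq_card.
split=> //; move: mP; rewrite leq_eqVlt => /orP[/eqP mP|]; [right|by move=> ?; left].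
(* With exactly [graph_size G] classes, every class contains an edge-vertex. *)
have fE : f @: [set: E] = P by apply/eqP; rewrite eqEcard fP cf mP leqnn.
pose h x : {set H} := pblock P (inl x).
suff hinj : injective h.
  rewrite /graph_order -cardsT -(card_imset _ hinj).
  by apply/subset_leq_card/subsetP=> _ /imsetP[x _ ->]; apply: inP.
(* Both [x] and [y] are ends of the edge [a] in their class, but they are not adjacent, so they
   coincide. *)
move=> x y hxy; have : h x \in P by apply: inP.
rewrite -fE => /imsetP[a _ hxa]; have aB : inr a \in h x by rewrite hxa inB.
have xa : x \in val a.
  by rewrite -[_ \in _]negbK -compl_central_lr; apply: (@indep _ _ (inl x)).
have ya : y \in val a.
  rewrite -[_ \in _]negbK -compl_central_lr.
  by apply: (@indep _ _ (inl x)); rewrite // -/(h x) hxy.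
have : ~~ adj x y.
  by rewrite -compl_central_ll; apply: (@indep _ _ (inl x)); rewrite // -/(h x) hxy.
have /edgesP[u [v [uv ae]]] := valP a.
move: xa ya; rewrite ae !inE => /orP[]/eqP-> /orP[]/eqP->; rewrite ?uv //.
by rewrite adj_sym uv.
Qed.

End Graph.

(** The nonempty fibres of [c] are the color classes, so [c] need not be onto. *)
Lemma tdc_number_le_card (H : sgraph) (K : finType) (c : H -> K) :
  (forall u v, adj u v -> c u != c v) ->
  (forall u, exists2 w, adj u w & forall v, c v = c w -> adj u v) ->
  tdc_number H <= #|K|.
Proof.
move=> prop dom.
have noiso : no_isolated H by move=> u; have [w uw _] := dom u; exists w.
have [_ /(_ [set c @^-1: [set k] | k in c @: [set: H]])] := tdc_numberP noiso.
have inB u : c @^-1: [set c u] \in [set c @^-1: [set k] | k in c @: [set: H]].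
  by apply/imset_f/imset_f.
move=> le; apply: leq_trans (le _) _; last first.
  exact: leq_trans (leq_imset_card _ _) (max_card _).
apply/andP; split; [apply/andP; split; [apply/and3P; split|]|].
- apply/eqP/setP=> u; rewrite inE; apply/bigcupP.
  by exists (c @^-1: [set c u]); rewrite // !inE.
- apply/trivIsetP=> _ _ /imsetP[k _ ->] /imsetP[l _ ->] kl.
  rewrite -setI_eq0; apply/set0Pn=> -[u]; rewrite !inE => /andP[/eqP uk /eqP ul].
  by rewrite -uk -ul eqxx in kl.
- apply/imsetP=> -[_ /imsetP[u _ ->]] /setP/(_ u).
  by rewrite !inE eqxx.
- apply/forall_inP=> _ /imsetP[k _ ->].
  apply/forall_inP=> u; rewrite !inE => /eqP uk.
  apply/forall_inP=> v; rewrite !inE => /eqP vk.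
  by apply/negP=> /prop; rewrite uk vk eqxx.
- apply/forallP=> u; have [w _ dw] := dom u.
  apply/existsP; exists (c @^-1: [set c w]); rewrite inB /=.
  by apply/forall_inP=> v; rewrite !inE => /eqP/dw.
Qed.

(** * Upper bound by the size when there is a cycle *)

Section Upper.
Variable G : sgraph.
Hypothesis conn : forall x y : G, connect (@adj G) x y.
Implicit Types (x y v w : G).

Notation E := {a : {set G} | a \in edges G}.
Notation H := (compl_graph (central_graph G)).

(** [a0] is the default where the pair is not an edge, which can happen only outside [D]. *)
Lemma edge_choice (g : G -> G) (D : {pred G}) (a0 : E) :
  (forall v, v \in D -> adj v (g v)) ->
  exists f : G -> E, forall v, v \in D -> val (f v) = [set v; g v].
Proof.
move=> ag; exists (fun v => insubd a0 [set v; g v]) => v vD.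
by apply: insubdK; apply/edge_of/ag.
Qed.

(** Two steps along the cycle do not return; from a vertex off it, two steps end on the cycle or
    strictly closer to it. *)
Lemma ucycle_succ (s : seq G) : 2 < size s -> ucycle (@adj G) s ->
  exists g : G -> G, forall v, adj v (g v) /\ g (g v) != v.
Proof.
move=> s3 /andP[cyc us].
have [s0 s0s] : exists s0, s0 \in s.
  by case: s s3 {cyc us} => // x s _; exists x; rewrite mem_head.
have [|p [d dp]] := @connect_descent G (@adj G) [set x in s].
  by move=> v; exists s0; rewrite ?inE ?conn.
exists (fun v => if v \in s then next s v else p v) => v.
have [vs|vs] := boolP (v \in s).
  by rewrite mem_next vs; split; [apply: next_cycle | apply: next_next_neq].
have [vp dv] : adj v (p v) /\ d (p v) < d v by apply: dp; rewrite inE.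
split=> //; have [ps|ps] := ifPn.
  by apply: contraNneq vs => <-; rewrite mem_next.
have [_ dpv] : adj (p v) (p (p v)) /\ d (p (p v)) < d (p v) by apply: dp; rewrite inE.
by apply: contraTneq dv => ppv; rewrite ppv in dpv; rewrite -leqNgt ltnW.
Qed.

Lemma tdc_number_le_size (g : G -> G) : 3 < graph_order G ->
  (forall v, adj v (g v) /\ g (g v) != v) -> tdc_number H <= graph_size G.
Proof.
move=> n4 gP; have ag v : adj v (g v) by case: (gP v).
have [v0 _] : exists v0 : G, v0 \in G by apply/card_gt0P; apply: leq_trans n4.
have [f fE] := @edge_choice g predT (exist (fun a => a \in edges G) _ (edge_of (ag v0))) (fun v _ => ag v).
have {}fE v : val (f v) = [set v; g v] by apply: fE.
have memf v : v \in val (f v) by rewrite fE !inE eqxx.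
(* Distinct [v] and [w] with the same edge would satisfy [g v = w] and [g w = v]. *)
have finj : injective f.
  move=> v w /(congr1 val); rewrite !fE => /set2_eq[[]//|[vw gv]].
  by have [_] := gP v; rewrite gv -vw eqxx.
pose c (u : H) : E := match u with inl v => f v | inr a => a end.
rewrite -card_edge_type; apply: (@tdc_number_le_card _ _ c).
  move=> [x|a] [y|b]; rewrite compl_centralE /=.
  - by move=> xy; apply: contraTneq xy => /finj->; rewrite adj_irr.
  - by apply: contraNneq => <-.
  - by apply: contraNneq => ->.
  - by [].
move=> [x|a].
  (* The class of [g x] is [g x] with the edge from it to [g (g x)], and this edge avoids [x]. *)
  exists (inl (g x)); first by rewrite compl_central_ll.
  move=> [w|b]; rewrite compl_centralE /=; first by move/finj->.
  have [_ ggx] := gP x.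
  by move=> ->; rewrite fE !inE negb_or (adj_neq (ag x)) eq_sym.
(* The class of a vertex [v] off [a] dominates [a]: its edge [f v] contains [v], so it is not
   [a]. *)
have [v va] : exists v, v \notin val a.
  have : 0 < #|~: val a|.
    rewrite cardsCs setCK subn_gt0; apply: leq_ltn_trans (card_edge a) _.
    exact: leq_trans n4.
  by case/card_gt0P=> v; rewrite inE; exists v.
exists (inl v); first by rewrite compl_centralE.
move=> [w|b]; rewrite compl_centralE /=; first by move/finj->.
by move->; apply: contraNneq va => ->.
Qed.

(** * Rooted spanning trees: parent [p] and depth [d] *)

Lemma rooted_parent (r : G) : exists (p : G -> G) (d : G -> nat),
  forall v, v != r -> adj v (p v) /\ d (p v) < d v.
Proof.
have [|p [d pd]] := @connect_descent G (@adj G) [set r].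
  by move=> v; exists r; rewrite ?inE ?conn.
by exists p, d => v vr; apply: pd; rewrite inE.
Qed.

(** A vertex closest to an edge, among those off it, is adjacent to one of its ends and extends it
    to a path. *)
Lemma exists_path3 : 2 < graph_order G ->
  exists r c b : G, [/\ adj r c, adj c b & r != b].
Proof.
move=> n3.
have [x _] : exists x : G, x \in G by apply/card_gt0P; apply: leq_trans n3.
have [z zx] : exists z, z != x.
  have : 0 < #|[set~ x]| by rewrite cardsC1 -subn1 subn_gt0; apply: leq_trans n3.
  by case/card_gt0P=> z; rewrite !inE; exists z.
have [y zy] : exists y, adj z y.
  by have [p [d pd]] := rooted_parent x; exists (p z); have [] := pd z zx.
have [|p [d pd]] := @connect_descent G (@adj G) [set z; y].
  by move=> v; exists z; rewrite ?inE ?eqxx ?conn.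
have [w0 w0S] : exists w, w \notin [set z; y].
  have : 0 < #|~: [set z; y]|.
    rewrite cardsCs setCK subn_gt0; apply: leq_ltn_trans n3.
    by rewrite cards2; case: (_ != _).
  by case/card_gt0P=> v; rewrite inE; exists v.
case: (@arg_minnP _ w0 [pred w | w \notin [set z; y]] d w0S) => w wS wmin; have [wp dw] := pd w wS.
have : p w \in [set z; y].
  by apply: contraTT dw => /wmin; rewrite -leqNgt.
move: wS; rewrite !inE negb_or => /andP[wz wy] /orP[]/eqP pw.
  by exists w, z, y; rewrite -{1}pw.
by exists w, y, z; rewrite -{1}pw adj_sym in wp *; split; rewrite // adj_sym.
Qed.

Section Rooted.
Variables (r : G) (p : G -> G) (d : G -> nat).
Hypothesis pd : forall v, v != r -> adj v (p v) /\ d (p v) < d v.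

(** Otherwise [v] and [w] would be parents of each other, each deeper than the other. *)
Lemma parent_edge_inj v w : v != r -> w != r ->
  [set v; p v] = [set w; p w] -> v = w.
Proof.
move=> vr wr /set2_eq[[]//|[vw pv]].
have [_ dv] := pd vr; have [_ dw] := pd wr.
by move: dv; rewrite pv vw ltnNge ltnW.
Qed.

Lemma graph_order_predC1 : graph_order G = #|predC1 r|.+1.
Proof. by rewrite cardC1 prednK //; apply/card_gt0P; exists r. Qed.

Lemma leq_order_size : graph_order G <= (graph_size G).+1.
Proof.
rewrite graph_order_predC1 ltnS.
have inj : {in predC1 r &, injective (fun v => [set v; p v])}.
  by move=> v w; rewrite !inE; apply: parent_edge_inj.
rewrite -(card_in_imset inj); apply/subset_leq_card/subsetP=> _ /imsetP[v vr ->].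
by apply: edge_of; have [] := pd vr.
Qed.

(* A non-tree edge [xy] closes a cycle: the tree paths keep [x] and [y]
   connected after its removal. *)
Lemma acyclic_parent_edge x y : acyclic_graph G -> adj x y ->
  exists2 v, v != r & [set x; y] = [set v; p v].
Proof.
move=> acy xy.
suff /existsP[v /andP[vr /eqP ve]] : [exists v, (v != r) && ([set x; y] == [set v; p v])].
  by exists v.
apply: contraT; rewrite negb_exists => /forallP no; exfalso.
pose e' := [rel u v : G | adj u v && ([set u; v] != [set x; y])].
have e'sym : connect_sym e'.
  by apply: sym_connect_sym => u v /=; rewrite adj_sym setUC.
have toroot v : connect e' v r.
  have [k] := ubnP (d v); elim: k v => // k IH v dk.
  have [->|vr] := eqVneq v r; first exact: connect0.
  have [vp dv] := pd vr.
  apply: connect_trans (IH _ (leq_trans dv dk)); apply: connect1 => /=.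
  by move: (no v); rewrite vr vp eq_sym.
have : connect e' x y by apply: connect_trans (toroot x) _; rewrite e'sym.
case/connectP=> q pq yq; case: (shortenP pq) yq => {pq} q' pq' uq _ yq.
apply: (acy (x :: q')).
  (* The path has an inner vertex: a single step from [x] to [y] would use the removed edge. *)
  case: q' pq' uq yq => [|z [|? q']] //=.
    by move=> _ _ yx; move: xy; rewrite yx adj_irr.
  by move=> /andP[/andP[_ ne] _] _ yz; rewrite yz eqxx in ne.
rewrite /ucycle uq andbT /= rcons_path -yq [adj y x]adj_sym xy andbT.
by apply: sub_path pq' => u v /andP[].
Qed.

(** Every edge is now the parent edge of a vertex other than [r]. *)
Lemma acyclic_size : acyclic_graph G -> graph_order G = (graph_size G).+1.
Proof.
move=> acy; apply/eqP; rewrite eqn_leq leq_order_size /=.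
rewrite graph_order_predC1 ltnS.
rewrite /graph_size.
have -> : edges G = [set [set v; p v] | v in predC1 r].
  apply/setP=> a; apply/edgesP/imsetP.
    case=> x [y [xy ->]]; have [v vr ->] := acyclic_parent_edge acy xy.
    by exists v.
  by case=> v vr ->; exists v, (p v); have [] := pd vr.
exact: leq_imset_card.
Qed.

End Rooted.

(** * Upper bound by the order for a tree *)

Lemma tree_tdc_number_le : 3 < graph_order G -> acyclic_graph G ->
  tdc_number H <= graph_order G.
Proof.
move=> n4 acy; have [r [c [b [rc cb rb]]]] := exists_path3 (ltnW n4).
have nrb : ~~ adj b r.
  apply/negP=> br; apply: (acy [:: r; c; b]) => //.
  rewrite /ucycle /= rc cb br !inE negb_or (adj_neq rc) rb.
  by rewrite (adj_neq cb).
have [p [d pd]] := rooted_parent r.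
have ap v (vr : v \in predC1 r) : adj v (p v) by case: (pd v vr).
have cr : c != r by rewrite eq_sym adj_neq.
have br : b != r by rewrite eq_sym.
have bc : b != c by rewrite eq_sym adj_neq.
(* Every edge is a parent edge, which forces the parents of [c] and then of [b]. *)
have pc : p c = r.
  have [v vr] := acyclic_parent_edge pd acy rc.
  case/set2_eq=> -[]; first by move=> rv; rewrite rv eqxx in vr.
  by move=> -> ->.
have pb : p b = c.
  have [v vr] := acyclic_parent_edge pd acy cb.
  case/set2_eq=> -[]; last by move=> -> ->.
  by move=> cv bv; rewrite bv -cv pc eqxx in br.
have [f fE] := edge_choice (exist (fun a => a \in edges G) _ (edge_of rc)) ap.
have {}fE v : v != r -> val (f v) = [set v; p v] by apply: fE.
have memf v : v != r -> v \in val (f v) by move=> vr; rewrite fE // !inE eqxx.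
have finj v w : v != r -> w != r -> f v = f w -> v = w.
  by move=> vr wr /(congr1 val); rewrite !fE //; apply: (parent_edge_inj pd).
have fb : val (f b) = [set b; c] by rewrite fE // pb.
have fc : val (f c) = [set c; r] by rewrite fE // pc.
pose S : {pred G} := pred2 r b.
have Sr v : v \notin S -> v != r by rewrite inE negb_or => /andP[].
have Sb v : v \notin S -> v != b by rewrite inE negb_or => /andP[].
(* [None] is the color of the extra class made of [r] and [b]. *)
pose k (u : H) : option E :=
  match u with inl v => if v \in S then None else Some (f v) | inr a => Some a end.
rewrite (acyclic_size pd acy) -card_edge_type -card_option.
apply: (@tdc_number_le_card _ _ k).
  move=> [x|a] [y|a']; rewrite compl_centralE /=.
  - move=> xy; case: ifPn => xS; case: ifPn => yS //.
      move: xS yS xy; rewrite !inE => /orP[]/eqP-> /orP[]/eqP->;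
        by rewrite ?adj_irr ?(negPf nrb) // adj_sym (negPf nrb).
    apply: contraTneq xy => -[/finj->]; rewrite ?adj_irr ?Sr //.
  - by move=> xa; case: ifPn => // /Sr xr; apply: contraNneq xa => -[<-]; apply: memf.
  - by move=> ya; case: ifPn => // /Sr yr; apply: contraNneq ya => -[->]; apply: memf.
  - by apply: contraNneq => -[->].
have class_fb u : k u = Some (f b) -> u = inr (f b).
  case: u => [v|a] /=; last by case=> ->.
  case: ifPn => // vS [/finj] vb.
  by move: (Sb _ vS); rewrite vb ?eqxx // Sr.
have class_f v u : v \notin S -> k u = Some (f v) -> u = inl v \/ u = inr (f v).
  move=> vS; case: u => [w|a] /=; last by case=> ->; right.
  by case: ifPn => // wS [/finj->]; rewrite ?Sr //; left.
move=> [x|a].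
  (* Off the edge [{b, c}], its singleton class dominates [x]; [c] is dominated by the class of [r]
     and [b], and [b] by that of [c]. *)
  have [xb|] := boolP (x \in val (f b)); last first.
    by exists (inr (f b)) => // v /class_fb->.
  move: xb; rewrite fb !inE => /orP[]/eqP->; last first.
    exists (inl r); first by rewrite compl_central_ll adj_sym.
    have rS : r \in S by rewrite inE eqxx.
    move=> [v|a]; rewrite compl_centralE /= rS //.
    by case: ifPn => //; rewrite inE => /orP[]/eqP-> _; rewrite // adj_sym.
  have cS : c \notin S by rewrite inE negb_or cr eq_sym.
  exists (inl c); first by rewrite compl_central_ll adj_sym.
  move=> u; rewrite {2}/k (negPf cS) => /(class_f _ _ cS)[]->.
    by rewrite compl_central_ll adj_sym.
  by rewrite compl_central_lr fc !inE negb_or bc br.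
have [->|ab] := eqVneq a (f b); last first.
  by exists (inr (f b)) => [|v /class_fb->]; rewrite compl_central_rr.
(* The edge [{b, c}] cannot dominate itself; a fourth vertex [v] supplies a class that avoids it. *)
have [v vS vc] : exists2 v, v \notin S & v != c.
  have : 0 < #|~: [set r; b; c]|.
    rewrite cardsCs setCK subn_gt0; apply: leq_ltn_trans n4.
    apply: leq_trans (leq_card_setU _ _) _; rewrite cards1 cards2.
    by case: (_ != _).
  case/card_gt0P=> v; rewrite !inE !negb_or => /andP[/andP[vr vb] vc].
  by exists v; rewrite // inE negb_or vr.
have vfb : v \notin val (f b) by rewrite fb !inE negb_or vc Sb.
exists (inl v) => // u; rewrite {2}/k (negPf vS) => /(class_f _ _ vS)[]-> //.
by rewrite compl_central_rr; apply: contraNneq vfb => ->; apply/memf/Sr.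
Qed.

End Upper.

Theorem theorem4p2 (G : sgraph) (n m : nat)
  (hconn : connected_graph G)
  (hn : graph_order G = n) (hn4 : 4 <= n)
  (hm : graph_size G = m) :
  (is_tree G -> tdc_number (compl_graph (central_graph G)) = n) /\
  (~ is_tree G -> tdc_number (compl_graph (central_graph G)) = m).
Proof.
move: hn4; rewrite -hn -hm => n4; have [n0 conn] := hconn.
have noiso := compl_central_no_isolated hconn (ltnW n4).
have [[P /andP[/proper_coloring_lower[mP mnP] _] PE] _] := tdc_numberP noiso.
rewrite PE in mP mnP; split=> [[_ acy]|ntree]; apply/eqP; rewrite eqn_leq.
  (* In a tree the order is the size plus one, so exceeding the size also gives the bound. *)
  rewrite tree_tdc_number_le //=; case: mnP => //.
  have [r _] : exists r : G, r \in G by apply/card_gt0P.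
  have [p [d pd]] := rooted_parent conn r.
  by rewrite (acyclic_size pd acy).
rewrite mP andbT; apply: contraT => lt; case: ntree; split=> // s s3 cyc.
have [g gP] := ucycle_succ conn s3 cyc.
by rewrite (tdc_number_le_size n4 gP) in lt.
Qed.
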